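(* Let $(f_n)_{n\geq0}$ be a real recurrence sequence which is not identically zero and which has no positive real dominating characteristic root. Then the sets $\{n\in\mathbb{N} : f_n>0\}$ and $\{n\in\mathbb{N}: f_n<0\}$ both have positive natural density (in particular, their densities exist).
   Context: A real sequence $(f_n)_{n\geq 0}$ is a recurrence sequence if $f_{n+h} = c_1 f_{n+h-1} + \dots + c_h f_n$ for all $n\geq 0$, for some $h\geq1$ and $c_k\in\mathbb{R}$. Such a sequence can be written uniquely as a generalized power sum $f_n=\sum_{k=0}^m P_k(n)\gamma_k^n$ with distinct $\gamma_k\in\mathbb{C}$ and nonzero polynomials $P_k\in\mathbb{C}[n]$; the $\gamma_k$ are its characteristic roots, and those of maximal modulus are its dominating roots. The natural density of $A\subseteq\mathbb{N}$ is $\lim_{x\to\infty}x^{-1}\#\{n\leq x: n\in A\}$ when it exists.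
   Formalization: The recurrence is required to have c_h ≠ 0 and characteristic roots are nonzero; otherwise 1, 0, 0, … (f_{n+1} = 0·f_n) would be a counterexample and the unique power-sum form could fail. *)

(* Defs.v *)
From HB Require Import structures.
From mathcomp Require Import all_boot all_order all_algebra.
From mathcomp Require Import all_classical all_reals all_analysis.
From mathcomp.real_closed Require Import complex.

Set Implicit Arguments.
Unset Strict Implicit.
Unset Printing Implicit Defensive.

Import Order.TTheory GRing.Theory Num.Theory.
Import numFieldNormedType.Exports.

Local Open Scope classical_set_scope.
Local Open Scope ring_scope.
Local Open Scope complex_scope.

(* The trailing coefficient c h is required to be nonzero.  This is exactly
   what makes f a generalized power sum for all n >= 0: without it 1, 0, 0, ...
   would be a recurrence sequence (f (n + 1) = 0 * f n) without any nonzero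
   characteristic root. *)
Definition recurrence_sequence (R : realType) (f : nat -> R) : Prop :=
  exists (h : nat) (c : nat -> R),
    [/\ (1 <= h)%N, c h != 0 &
      forall n : nat,
        f (n + h)%N = \sum_(1 <= k < h.+1) c k * f (n + h - k)%N].

(* The bases must be nonzero: P.[n] * 0 ^+ n only depends on P.[0], so the
   representation would otherwise not be unique. *)
Definition generalized_power_sum (R : realType) (f : nat -> R) (m : nat)
    (gamma : 'I_m -> R[i]) (P : 'I_m -> {poly R[i]}) : Prop :=
  [/\ injective gamma,
      (forall k, gamma k != 0),
      (forall k, P k != 0) &
      forall n : nat, (f n)%:C = \sum_(k < m) (P k).[n%:R] * gamma k ^+ n].

Definition characteristic_root (R : realType) (f : nat -> R) (z : R[i]) : Prop :=
  exists (m : nat) (gamma : 'I_m -> R[i]) (P : 'I_m -> {poly R[i]}),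
    generalized_power_sum f gamma P /\ exists k, z = gamma k.

Definition dominating_root (R : realType) (f : nat -> R) (z : R[i]) : Prop :=
  characteristic_root f z /\
  forall w : R[i], characteristic_root f w -> `|w| <= `|z|.

Definition has_natural_density (R : realType) (A : set nat) (d : R) : Prop :=
  (fun x : nat => #|[set n : 'I_x.+1 | (n : nat) \in A]%SET|%:R / x%:R : R)
    @ \oo --> d.

(* Main.v *)
Require Import Defs.
From HB Require Import structures.
From mathcomp Require Import all_boot all_order all_algebra.
From mathcomp Require Import all_classical all_reals all_analysis.
From mathcomp.real_closed Require Import complex.
From mathcomp Require Import zify ring lra.

Import Order.TTheory GRing.Theory Num.Theory.
Import numFieldNormedType.Exports.

Local Open Scope classical_set_scope.
Local Open Scope ring_scope.
Local Open Scope complex_scope.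

Set Implicit Arguments.
Unset Strict Implicit.
Unset Printing Implicit Defensive.

(** Dividing f n by rho ^+ n * n ^+ D, where rho is the dominating modulus and D
the largest degree occurring there, leaves a real sequence r = g + o(1) with
g n = \sum_z c z * z ^+ n a trigonometric polynomial, |z| = 1.

Existence of the density.  Passing to the subsequences f (M * n + b) for a
suitable M, no quotient of two distinct frequencies is a root of unity.  Then g
is rarely small (induction on the number of frequencies).  Every polynomial in r
is again a trigonometric polynomial up to o(1), hence has a mean; approximating
the Heaviside function by polynomials away from 0 shows that the indicator of
r > 0 has a mean as well.

Positivity.  Without positive dominating root, r has mean 0, while r ^+ 2 has
mean \sum_z |c z| ^+ 2 > 0.  If |r| <= B then
r ^+ 2 <= 2 * B ^+ 2 * [r > 0] - B * r, so [r > 0] has positive mean. *)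

(** * Exponential polynomials and linear recurrences *)

Section ExponentialPolynomials.
Variable K : numFieldType.
Implicit Types (F : nat -> K) (s : seq (K * {poly K})) (t : seq K).

Definition exp_poly s n : K := \sum_(p <- s) p.2.[n%:R] * p.1 ^+ n.

Definition is_exp_poly F :=
  exists2 s, all (fun p => p.1 != 0) s & forall n, F n = exp_poly s n.

Definition normal_form F t (P : K -> {poly K}) :=
  [/\ uniq t, 0 \notin t, {in t, forall z, P z != 0} &
      forall n, F n = \sum_(z <- t) (P z).[n%:R] * z ^+ n].

Lemma coef_X1n n i : (('X + 1 : {poly K}) ^+ n)`_i = 'C(n, i)%:R.
Proof.
rewrite exprDn coef_sum (eq_bigr (fun j : 'I_n.+1 => if (n - j == i)%N then 'C(n, j)%:R else 0)).
  case: (leqP i n) => [le_in|lt_ni].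
    rewrite (bigD1 (Ordinal (leq_subr i n : n - i < n.+1)%N)) //= subKn // eqxx.
    rewrite bin_sub // big1 ?addr0 // => j /eqP jNi; case: eqP => // Ej.
    by case: jNi; apply/val_inj => /=; rewrite -Ej subKn // -ltnS.
  rewrite bin_small // big1 // => j _; case: eqP => // Ej; lia.
by move=> j _; rewrite expr1n mulr1 coefMn coefXn eq_sym; case: eqP; rewrite ?mul0rn.
Qed.

(** On a monomial the operator keeps the degree and multiplies the top coefficient by [mu - 1],
    unless [mu = 1], when it lowers the degree by one and multiplies by the old degree, nonzero in
    characteristic 0. So one monomial cancels the top term of [Q], and induction on the size does
    the rest. *)
Lemma difference_equation_solvable (mu : K) (Q : {poly K}) :
  exists Q', mu *: (Q' \Po ('X + 1)) - Q' = Q.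
Proof.
have [n] := ubnP (size Q); elim: n Q => // n IHn Q; rewrite ltnS => szQ.
suff [Q1 HQ1] : exists Q1, (size (Q - (mu *: (Q1 \Po ('X + 1)) - Q1))%R < n)%N \/ Q = mu *: (Q1 \Po ('X + 1)) - Q1.
  case: HQ1 => [HQ1|HQ1]; last by exists Q1.
  have [Q2 HQ2] := IHn _ HQ1.
  exists (Q1 + Q2); rewrite comp_polyD scalerDr opprD addrACA HQ2; exact: subrKC.
case: n szQ {IHn} => [|n] szQ.
  exists 0; right; rewrite comp_poly0 scaler0 subr0.
  by apply/eqP; rewrite -size_poly_eq0; case: size szQ.
have [mu1|mu1] := eqVneq mu 1.
  exists ((Q`_n / n.+1%:R) *: 'X^(n.+1)); left; rewrite ltnS.
  rewrite mu1 scale1r comp_polyZ comp_Xn_poly -scalerBr.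
  apply/leq_sizeP => j le_nj; rewrite coefB coefZ coefB coef_X1n coefXn.
  have [<-|nj] := eqVneq n j.
    by rewrite binSn ltn_eqF // subr0 divfK ?subrr // pnatr_eq0.
  have lt_nj : (n < j)%N by rewrite ltn_neqAle nj.
  rewrite nth_default ?(leq_trans szQ) // sub0r.
  have [->|nj1] := eqVneq j n.+1; first by rewrite binn subrr mulr0 oppr0.
  by rewrite bin_small ?subr0 ?mulr0 ?oppr0 // ltn_neqAle eq_sym nj1.
exists ((Q`_n / (mu - 1)) *: 'X^n); left; rewrite ltnS.
rewrite comp_polyZ comp_Xn_poly scalerA [mu * _]mulrC -[(_ * mu) *: _]scalerA -scalerBr.
apply/leq_sizeP => j le_nj; rewrite coefB coefZ coefB coefZ coef_X1n coefXn.
have [<-|nj] := eqVneq n j.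
  by rewrite binn mulr1 divfK ?subrr // subr_eq0.
rewrite bin_small; last by rewrite ltn_neqAle nj.
rewrite mulr0 subrr mulr0 subr0 nth_default // (leq_trans szQ) //.
by rewrite ltn_neqAle nj.
Qed.

(** A particular solution is found term by term; what remains solves the homogeneous equation and is
    geometric. *)
Lemma first_order_exp_poly F (z : K) : z != 0 ->
  is_exp_poly (fun n => F n.+1 - z * F n) -> is_exp_poly F.
Proof.
move=> z0 [s s0 Hs].
have [s' s'0 Hs'] : exists2 s', all (fun p : K * {poly K} => p.1 != 0) s' &
    forall n, exp_poly s' n.+1 - z * exp_poly s' n = exp_poly s n.
  elim: s s0 {Hs} => [_|[g Q] s IHs /= /andP[g0 /IHs[s' s'0 Hs']]].
    by exists [::] => // n; rewrite /exp_poly !big_nil mulr0 subr0.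
  (* Inserting [Q'.[n] * g ^+ n] into the equation leaves [z * (mu * Q'.[n + 1] - Q'.[n])] in front
     of [g ^+ n], with [mu = g / z]. *)
  have [Q' HQ'] := difference_equation_solvable (g / z) (z^-1 *: Q).
  exists ((g, Q') :: s'); first by rewrite /= g0.
  move=> n; have := Hs' n; rewrite /exp_poly !big_cons /= => <-.
  rewrite mulrDr opprD addrACA; congr (_ + _).
  have HQn : g / z * Q'.[n%:R + 1] - Q'.[n%:R] = z^-1 * Q.[n%:R].
    by rewrite -[RHS]hornerZ -HQ' hornerD hornerZ hornerN horner_comp !hornerE.
  have -> : Q.[n%:R] = z * (z^-1 * Q.[n%:R]) by rewrite mulVKf.
  by rewrite -HQn -natr1 exprS; field.
pose w n := F n - exp_poly s' n.
have wS n : w n.+1 = z * w n.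
  by rewrite /w -[F n.+1](subrK (z * F n)) Hs -Hs'; ring.
have wE n : w n = w 0%N * z ^+ n.
  by elim: n => [|n IHn]; rewrite ?mulr1 // wS IHn exprS mulrCA.
exists ((z, (w 0%N)%:P) :: s'); first by rewrite /= z0.
by move=> n; rewrite /exp_poly big_cons /= hornerC -wE /w -/(exp_poly _ _) subrK.
Qed.

(** The polynomial [p] evaluated at the shift operator and applied to [F]. *)
Definition shift_act (p : {poly K}) F n := \sum_(i < size p) p`_i * F (n + i)%N.

Lemma shift_act_widen (p : {poly K}) F n m : (size p <= m)%N ->
  shift_act p F n = \sum_(i < m) p`_i * F (n + i)%N.
Proof.
move=> le_pm; rewrite /shift_act (big_ord_widen m (fun i => p`_i * F (n + i)%N)) //.
rewrite big_mkcond; apply: eq_bigr => i _; case: ltnP => // ?.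
by rewrite nth_default ?mul0r.
Qed.

Lemma shift_act_XsubC_mul (p : {poly K}) F z n :
  shift_act (('X - z%:P) * p) F n = shift_act p (fun n => F n.+1 - z * F n) n.
Proof.
have szp : (size (('X - z%:P) * p)%R <= (size p).+1)%N.
  by apply: leq_trans (size_polyMleq _ _) _; rewrite size_XsubC.
rewrite (shift_act_widen _ _ szp).
under eq_bigr do rewrite mulrBl coefB coefXM coefCM mulrBl.
rewrite sumrB big_ord_recl /= mul0r add0r big_ord_recr /= nth_default //.
rewrite mulr0 mul0r addr0 -sumrB /shift_act; apply: eq_bigr => i _.
by rewrite /bump /= add1n /= addnS; ring.
Qed.

(** The linear factors are peeled off one at a time, each being a first-order equation. *)
Lemma exp_poly_of_annihilator (zs : seq K) F : 0 \notin zs ->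
  (forall n, shift_act (\prod_(z <- zs) ('X - z%:P)) F n = 0) -> is_exp_poly F.
Proof.
elim: zs F => [|z zs IHzs] F.
  move=> _ HF; exists [::] => // n; have := HF n.
  rewrite big_nil /shift_act size_poly1 big_ord1 coef1 /= mul1r addn0 => ->.
  by rewrite /exp_poly big_nil.
rewrite in_cons negb_or eq_sym => /andP[z0 zs0] HF.
apply: (first_order_exp_poly z0); apply: IHzs => // n.
by rewrite -shift_act_XsubC_mul -(HF n) big_cons.
Qed.

(** Terms with equal bases are added up, and bases whose polynomials cancel are dropped. The
    inclusion of [t] in the old bases later identifies its elements as powers of known roots. *)
Lemma exp_poly_normal_form F s : all (fun p => p.1 != 0) s ->
  (forall n, F n = exp_poly s n) ->
  exists t P, normal_form F t P /\ {subset t <= map fst s}.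
Proof.
move=> s0 HF.
pose P z := \sum_(p <- s | p.1 == z) p.2.
exists [seq z <- undup (map fst s) | P z != 0], P; split; last first.
  by move=> z; rewrite mem_filter mem_undup => /andP[].
split.
- exact/filter_uniq/undup_uniq.
- rewrite mem_filter mem_undup; apply/negP => /andP[_ /mapP[p ps p0]].
  by have := allP s0 _ ps; rewrite -p0 eqxx.
- by move=> z; rewrite mem_filter => /andP[].
move=> n; rewrite HF big_filter big_mkcond /=.
under [RHS]eq_bigr => z _.
  rewrite (_ : (if _ then _ else _) = \sum_(p <- s | p.1 == z) p.2.[n%:R] * p.1 ^+ n).
    over.
  rewrite -[LHS](_ : (P z).[n%:R] * z ^+ n = _).
    rewrite /P horner_sum mulr_suml; apply: eq_bigr => p /eqP <- //.
  by case: eqP => //= ->; rewrite horner0 mul0r.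
rewrite (exchange_big_dep predT) //= /exp_poly big_seq [RHS]big_seq.
apply: eq_bigr => p ps; rewrite -big_filter.
rewrite (_ : [seq _ <- _ | _] = [:: p.1]) ?big_seq1 //.
rewrite (eq_filter (a2 := pred1 p.1)); last by move=> z /=; rewrite eq_sym.
by rewrite filter_pred1_uniq ?undup_uniq // mem_undup map_f.
Qed.

Lemma common_torsion_exponent (L : seq K) :
  exists2 M, (0 < M)%N & {in L, forall u j, (0 < j)%N -> u ^+ j = 1 -> u ^+ M = 1}.
Proof.
elim: L => [|u L [M M0 HM]]; first by exists 1%N.
have [[q q0 uq]|Nu] := pselect (exists2 q, (0 < q)%N & u ^+ q = 1).
  exists (q * M)%N; first by rewrite muln_gt0 q0.
  move=> v; rewrite in_cons => /predU1P[->|vL] j j0 vj.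
    by rewrite exprM uq expr1n.
  by rewrite mulnC exprM (HM _ vL j) // expr1n.
exists M => // v; rewrite in_cons => /predU1P[->|vL] j j0 vj; last exact: (HM v vL j).
by case: Nu; exists j.
Qed.

(** [M] kills every root of unity among the quotients [z / w], so a quotient of [M]-th powers that
    is a root of unity is 1. *)
Lemma nondegeneracy_exponent t : 0 \notin t ->
  exists2 M, (0 < M)%N & {in t &, forall z w j, (0 < j)%N ->
    (z ^+ M) ^+ j = (w ^+ M) ^+ j -> z ^+ M = w ^+ M}.
Proof.
move=> t0; have [M M0 HM] := common_torsion_exponent [seq z / w | z <- t, w <- t].
exists M => // z w zt wt j j0 zw.
have wN0 : w != 0 by apply: contraNneq t0 => <-.
have /HM : z / w \in [seq z / w | z <- t, w <- t] by apply/allpairsP; exists (z, w).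
move=> /(_ (M * j)%N); rewrite muln_gt0 M0 j0 => /(_ isT).
rewrite !expr_div_n !exprM zw divff ?expf_neq0 // => /(_ erefl) E.
by rewrite -[LHS](divfK (expf_neq0 M wN0)) E mul1r.
Qed.

Lemma exp_poly_subsequence s (M b n : nat) :
  exp_poly s (M * n + b) =
  exp_poly [seq (p.1 ^+ M, p.1 ^+ b *: (p.2 \Po (M%:R *: 'X + b%:R%:P))) | p <- s] n.
Proof.
rewrite /exp_poly big_map; apply: eq_bigr => p _ /=.
by rewrite !hornerE horner_comp !hornerE exprD exprM natrD natrM; ring.
Qed.

End ExponentialPolynomials.

(** The characteristic polynomial [chi] splits over the complex numbers and annihilates the
    sequence; its constant coefficient is [- c h], so 0 is not among its roots. *)
Lemma recurrence_exp_poly (R : realType) (f : nat -> R) :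
  recurrence_sequence f -> is_exp_poly (fun n => (f n)%:C).
Proof.
case=> h [c [h1 ch0 Hf]].
pose q : {poly R[i]} := \poly_(i < h) (c (h - i)%N)%:C.
pose chi : {poly R[i]} := 'X^h - q.
have szq : (size q < size ('X^h : {poly R[i]}))%N by rewrite size_polyXn ltnS size_poly.
have sz_chi : size chi = h.+1 by rewrite /chi size_polyDl ?size_polyN // size_polyXn.
have chi_monic : lead_coef chi = 1.
  by rewrite /chi lead_coefDl ?size_polyN // lead_coefXn.
have [zs Hzs] := closed_field_poly_normal chi.
rewrite chi_monic scale1r in Hzs.
apply: (@exp_poly_of_annihilator _ zs).
  rewrite -root_prod_XsubC -Hzs rootE horner_coef0 /chi coefB coefXn coef_poly h1 subn0.
  rewrite ltn_eqF // sub0r oppr_eq0; apply: contra_neq ch0; exact: complexI.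
move=> n; rewrite -Hzs /shift_act sz_chi big_ord_recr /= /chi.
rewrite coefB coefXn eqxx coef_poly ltnn subr0 mul1r Hf.
rewrite big_add1 /= big_mkord raddf_sum (reindex_inj rev_ord_inj) /= -big_split big1 //= => i _.
have lt_ih := ltn_ord i.
rewrite coefB coefXn coef_poly ltn_eqF; last lia.
rewrite sub0r rmorphM (_ : (h - i.+1 < h)%N = true); last lia.
have -> : (h - (h - i.+1) = i.+1)%N by lia.
have -> : (n + (h - i.+1) = n + h - i.+1)%N by lia.
by rewrite mulNr addNr.
Qed.

(** * Null sequences, Cesàro means and trigonometric polynomials *)

Section ComplexSequences.
Variable R : realType.
Implicit Types (z w l : R[i]) (u v : nat -> R[i]) (s : seq (R[i] * R[i])).
Local Notation normc := ComplexField.Normc.normc.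

Lemma normcE z : `|z| = (normc z)%:C. Proof. by []. Qed.

Lemma normc_ge0 z : 0 <= normc z.
Proof. by rewrite -ler0c -normcE normr_ge0. Qed.

Lemma normc_eq0 z : (normc z == 0) = (z == 0).
Proof. by rewrite -(inj_eq (@complexI R)) -normcE normr_eq0. Qed.

Lemma normc_gt0 z : (0 < normc z) = (z != 0).
Proof. by rewrite lt_def normc_ge0 andbT normc_eq0. Qed.

Lemma normc0 : normc (0 : R[i]) = 0.
Proof. by apply/eqP; rewrite normc_eq0. Qed.

Lemma normcD z w : normc (z + w) <= normc z + normc w.
Proof. by rewrite -lecR rmorphD /= -!normcE ler_normD. Qed.

Lemma normcN z : normc (- z) = normc z.
Proof. by apply: complexI; rewrite -!normcE normrN. Qed.

Lemma normcM z w : normc (z * w) = normc z * normc w.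
Proof. by apply: complexI; rewrite rmorphM /= -!normcE normrM. Qed.

Lemma normcV z : normc z^-1 = (normc z)^-1.
Proof. by apply: complexI; rewrite fmorphV /= -!normcE normfV. Qed.

Lemma normcX z n : normc (z ^+ n) = normc z ^+ n.
Proof. by apply: complexI; rewrite rmorphXn /= -!normcE normrX. Qed.

Lemma normc_real (x : R) : normc x%:C = `|x|.
Proof. by rewrite /= expr0n addr0 sqrtr_sqr. Qed.

Lemma normc_nat n : normc (n%:R : R[i]) = n%:R.
Proof. by apply: complexI; rewrite -normcE normr_nat rmorph_nat. Qed.

Lemma normc1 : normc (1 : R[i]) = 1.
Proof. exact: (normc_nat 1). Qed.

Lemma normc_sum (I : Type) (r : seq I) (P : pred I) (F : I -> R[i]) :
  normc (\sum_(i <- r | P i) F i) <= \sum_(i <- r | P i) normc (F i).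
Proof.
elim/big_rec2: _ => [|i y x _ IH]; first by rewrite normc0.
by apply: le_trans (normcD _ _) _; rewrite lerD2l.
Qed.

Lemma normr_Re_le z : `|complex.Re z| <= normc z.
Proof. by have := normc_ge_Re z; rewrite normcE lecR. Qed.

(** Convergence to 0 is expressed through the real-valued modulus, so that real limit and squeeze
    arguments apply directly. *)
Definition vanishes u := (fun n => normc (u n)) @ \oo --> (0 : R).

Definition bounded_seq u := exists B : R, forall n, normc (u n) <= B.

Lemma vanishes_le u (a : nat -> R) :
  (\forall n \near \oo, normc (u n) <= a n) -> a @ \oo --> (0 : R) -> vanishes u.
Proof.
move=> ua a0; apply: (squeeze_cvgr _ (cvg_cst 0) a0).
by near=> n; rewrite normc_ge0 /=; near: n.
Unshelve. all: by end_near. Qed.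

Lemma vanishes_near u : vanishes u ->
  forall e : R, 0 < e -> \forall n \near \oo, normc (u n) < e.
Proof.
move=> u0 e e0; have /cvgrPdist_lt/(_ _ e0) := u0.
by apply: filterS => n; rewrite sub0r normrN ger0_norm ?normc_ge0.
Qed.

Lemma vanishes_ext u v : u =1 v -> vanishes u -> vanishes v.
Proof. by move=> /funext ->. Qed.

Lemma vanishes0 : vanishes (fun=> 0).
Proof. by rewrite /vanishes normc0; exact: cvg_cst. Qed.

Lemma vanishesD u v : vanishes u -> vanishes v -> vanishes (fun n => u n + v n).
Proof.
move=> u0 v0; apply: (@vanishes_le _ (fun n => normc (u n) + normc (v n))).
  by near=> n; exact: normcD.
by rewrite -[0]addr0; exact: cvgD.
Unshelve. all: by end_near. Qed.

Lemma vanishes_bounded_mul v u : bounded_seq v -> vanishes u ->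
  vanishes (fun n => v n * u n).
Proof.
move=> [B HB] u0; apply: (@vanishes_le _ (fun n => B * normc (u n))).
  by near=> n; rewrite normcM ler_wpM2r ?normc_ge0.
by rewrite -[0](mulr0 B); apply: cvgM => //; exact: cvg_cst.
Unshelve. all: by end_near. Qed.

Lemma bounded_seq_cst l : bounded_seq (fun=> l).
Proof. by exists (normc l). Qed.

Lemma vanishesZ l u : vanishes u -> vanishes (fun n => l * u n).
Proof. exact/vanishes_bounded_mul/bounded_seq_cst. Qed.

Lemma vanishesN u : vanishes u -> vanishes (fun n => - u n).
Proof. by move=> /(vanishesZ (-1)); apply: vanishes_ext => n; rewrite mulN1r. Qed.

Lemma vanishes_sum (I : eqType) (r : seq I) (F : I -> nat -> R[i]) :
  {in r, forall i, vanishes (F i)} -> vanishes (fun n => \sum_(i <- r) F i n).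
Proof.
elim: r => [_|i r IH Hr].
  by apply: vanishes_ext vanishes0 => n; rewrite big_nil.
apply: (@vanishes_ext (fun n => F i n + \sum_(i <- r) F i n)).
  by move=> n; rewrite big_cons.
apply: vanishesD; first by apply: Hr; rewrite mem_head.
by apply: IH => j jr; apply: Hr; rewrite in_cons jr orbT.
Qed.

Lemma bounded_seqD u v : bounded_seq u -> bounded_seq v ->
  bounded_seq (fun n => u n + v n).
Proof.
move=> [B HB] [B' HB']; exists (B + B') => n.
by apply: le_trans (normcD _ _) _; exact: lerD.
Qed.

Lemma vanishes_bounded u : vanishes u -> bounded_seq u.
Proof.
move=> u0; have /cvg_has_ub[B HB] : cvgn (fun n => normc (u n)) by apply/cvg_ex; exists 0.
exists B => n; have := HB `|normc (u n)|.
by rewrite ger0_norm ?normc_ge0 //; apply; exists n => //; rewrite ger0_norm ?normc_ge0.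
Qed.

Lemma vanishes_const l : vanishes (fun=> l) -> l = 0.
Proof.
move=> l0; apply/eqP; rewrite -normc_eq0.
by apply/eqP; have := @cvg_unique _ _ _ _ _ _ (@cvg_cst _ (normc l) _ \oo _) l0; apply.
Qed.

Definition mean_to u l := vanishes (fun N => (\sum_(n < N) u n) / N%:R - l).

Lemma mean_to_unique u l1 l2 : mean_to u l1 -> mean_to u l2 -> l1 = l2.
Proof.
move=> u1 u2; apply/eqP; rewrite -subr_eq0; apply/eqP/vanishes_const.
by apply: vanishes_ext (vanishesD u2 (vanishesN u1)) => N; ring.
Qed.

Lemma mean_toD u v l1 l2 : mean_to u l1 -> mean_to v l2 ->
  mean_to (fun n => u n + v n) (l1 + l2).
Proof.
move=> ul vl; apply: vanishes_ext (vanishesD ul vl) => N.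
by rewrite big_split /= mulrDl opprD addrACA.
Qed.

Lemma mean_toZ c u l : mean_to u l -> mean_to (fun n => c * u n) (c * l).
Proof.
move=> ul; apply: vanishes_ext (vanishesZ c ul) => N.
by rewrite -mulr_sumr mulrBr mulrA.
Qed.

Lemma mean_to_cst l : mean_to (fun=> l) l.
Proof.
apply: (@vanishes_le _ (fun=> 0)); last exact: cvg_cst.
near=> N; rewrite sumr_const card_ord -[l *+ N]mulr_natr.
have N0 : (0 < N)%N by near: N; exists 1%N.
by rewrite mulfK ?pnatr_eq0 -?lt0n // subrr normc0.
Unshelve. all: by end_near. Qed.

Lemma mean_to_vanishes u : vanishes u -> mean_to u 0.
Proof.
move=> /cesaro u0; rewrite /mean_to.
(* [arithmetic_mean] at index [N] averages [N + 1] terms, hence the predecessor. *)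
have : (fun N => arithmetic_mean (fun n => normc (u n)) N.-1) @ \oo --> (0 : R).
  by rewrite -cvg_shiftS.
apply: vanishes_le; near=> N.
have N0 : (0 < N)%N by near: N; exists 1%N.
rewrite subr0 normcM normcV normc_nat mulrC /arithmetic_mean /series /= prednK //.
by rewrite ler_pM2l ?invr_gt0 ?ltr0n // big_mkord normc_sum.
Unshelve. all: by end_near. Qed.

Lemma cvg_div_nat (B : R) : (fun N => B / N%:R) @ \oo --> (0 : R).
Proof.
rewrite -(cvg_shiftS (fun N => B / N%:R)).
have := @cvgM R _ \oo _ (fun=> B) (@harmonic R) B 0 (cvg_cst B) cvg_harmonic.
by rewrite mulr0 => H; exact: H.
Qed.

(** For [w != 1] the geometric sums stay below [2 / normc (w - 1)], so dividing by [N] sends them to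
    0. *)
Lemma mean_to_geometric w : normc w = 1 -> mean_to (fun n => w ^+ n) (w == 1)%:R.
Proof.
move=> w1; have [->|wN1] := eqVneq w 1.
  by under [X in mean_to X]eq_fun do rewrite expr1n; exact: mean_to_cst.
have wB : 0 < normc (w - 1) by rewrite normc_gt0 subr_eq0.
apply: (@vanishes_le _ (fun N => (2 / normc (w - 1)) / N%:R)); last exact: cvg_div_nat.
near=> N; rewrite subr0 normcM normcV normc_nat ler_wpM2r ?invr_ge0 ?ler0n //.
rewrite ler_pdivlMr // -normcM mulrC -subrX1.
by apply: le_trans (normcD _ _) _; rewrite normcN normcX w1 expr1n normc1.
Unshelve. all: by end_near. Qed.

Definition trig s n := \sum_(p <- s) p.1 * p.2 ^+ n.
Definition unimodular s := all (fun p => normc p.2 == 1) s.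

Lemma trig_bounded s : unimodular s -> bounded_seq (trig s).
Proof.
move=> s1; exists (\sum_(p <- s) normc p.1) => n.
apply: le_trans (normc_sum _ _ _) _; rewrite big_seq [leRHS]big_seq ler_sum // => p ps.
by rewrite normcM normcX (eqP (allP s1 _ ps)) expr1n mulr1.
Qed.

Lemma trig_mean s : unimodular s ->
  mean_to (trig s) (\sum_(p <- s) p.1 * (p.2 == 1)%:R).
Proof.
elim: s => [_|p s IHs /= /andP[/eqP p1 /IHs Hs]].
  by under [X in mean_to X]eq_fun do rewrite /trig big_nil; rewrite big_nil; exact: mean_to_cst.
under [X in mean_to X]eq_fun do rewrite /trig big_cons; rewrite big_cons.
exact: mean_toD (mean_toZ p.1 (mean_to_geometric p1)) Hs.
Qed.

Definition trig_mul s1 s2 := [seq (p.1 * q.1, p.2 * q.2) | p <- s1, q <- s2].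

Lemma trig_mulE s1 s2 n : trig (trig_mul s1 s2) n = trig s1 n * trig s2 n.
Proof.
rewrite /trig /trig_mul big_allpairs_dep mulr_suml; apply: eq_bigr => p _.
by rewrite mulr_sumr; apply: eq_bigr => q _ /=; rewrite exprMn mulrACA.
Qed.

Lemma unimodular_mul s1 s2 : unimodular s1 -> unimodular s2 -> unimodular (trig_mul s1 s2).
Proof.
move=> H1 H2; apply/allP => _ /allpairsP[[p q] [ps qs ->]] /=.
by rewrite normcM (eqP (allP H1 _ ps)) (eqP (allP H2 _ qs)) mulr1.
Qed.

(** This class contains the constants, is closed under sums and products, and consists of bounded
    sequences that have a mean; hence polynomials in a member have means too. *)
Definition asymp_trig u := exists2 s, unimodular s & vanishes (fun n => u n - trig s n).

Lemma asymp_trig_bounded u : asymp_trig u -> bounded_seq u.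
Proof.
case=> s s1 us; have := bounded_seqD (vanishes_bounded us) (trig_bounded s1).
by case=> B HB; exists B => n; have := HB n; rewrite subrK.
Qed.

Lemma asymp_trig_mean u : asymp_trig u -> exists l, mean_to u l.
Proof.
case=> s s1 us; have := mean_toD (mean_to_vanishes us) (trig_mean s1).
rewrite add0r => Hu; eexists; move: Hu.
by under [X in mean_to X]eq_fun do rewrite subrK; apply.
Qed.

Lemma asymp_trig_cst l : asymp_trig (fun=> l).
Proof.
exists [:: (l, 1)]; first by rewrite /unimodular all_seq1 normc1 eqxx.
by apply: vanishes_ext vanishes0 => n; rewrite /trig big_seq1 expr1n mulr1 subrr.
Qed.

Lemma asymp_trigD u v : asymp_trig u -> asymp_trig v -> asymp_trig (fun n => u n + v n).
Proof.
move=> [s s1 us] [t t1 vt]; exists (s ++ t); first by rewrite /unimodular all_cat; apply/andP.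
by apply: vanishes_ext (vanishesD us vt) => n; rewrite /trig big_cat /=; ring.
Qed.

Lemma asymp_trigM u v : asymp_trig u -> asymp_trig v -> asymp_trig (fun n => u n * v n).
Proof.
move=> Hu [t t1 vt]; case: (Hu) => s s1 us.
exists (trig_mul s t); first exact: unimodular_mul.
have Hv := vanishes_bounded_mul (asymp_trig_bounded Hu) vt.
have := vanishesD Hv (vanishes_bounded_mul (trig_bounded t1) us).
by apply: vanishes_ext => n; rewrite trig_mulE; ring.
Qed.

Lemma asymp_trigX u k : asymp_trig u -> asymp_trig (fun n => u n ^+ k).
Proof.
move=> Hu; elim: k => [|k IHk]; first exact: asymp_trig_cst.
by under [X in asymp_trig X]eq_fun do rewrite exprS; exact: asymp_trigM.
Qed.

Definition avg (a : nat -> R) N := (\sum_(n < N) a n) / N%:R.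

Lemma mean_to_avg (a : nat -> R) l : mean_to (fun n => (a n)%:C) l ->
  avg a @ \oo --> complex.Re l.
Proof.
move=> al; apply/cvgrPdist_lt => e e0.
have := vanishes_near al e0; apply: filterS => N; apply: le_lt_trans.
rewrite distrC; apply: le_trans _ (normr_Re_le _).
rewrite (_ : (\sum_(n < N) (a n)%:C) / N%:R = (avg a N)%:C) ?raddfB //.
by rewrite /avg rmorphM fmorphV rmorph_nat raddf_sum.
Qed.

End ComplexSequences.

(** * Leading asymptotics of an exponential polynomial *)

Lemma seq_argmax (disp : Order.disp_t) (T : eqType) (T' : orderType disp)
    (d : T -> T') (t : seq T) : t != [::] ->
  exists2 x, x \in t & {in t, forall y, d y <= d x}%O.
Proof.
elim: t => // x [_ _|y t IH _].
  by exists x; rewrite ?mem_head // => z; rewrite inE => /eqP ->.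
have [w wt Hw] := IH isT.
have [le_xw|lt_wx] := leP (d x) (d w).
  exists w; first by rewrite in_cons wt orbT.
  by move=> z; rewrite in_cons => /predU1P[->//|/Hw].
exists x; first by rewrite mem_head.
move=> z; rewrite in_cons => /predU1P[->//|/Hw le_zw].
exact: le_trans le_zw (ltW lt_wx).
Qed.

Section LeadingPart.
Variable R : realType.
Implicit Types (z w : R[i]) (q : {poly R[i]}).
Local Notation normc := ComplexField.Normc.normc.

(** The right side is [1 - x] times the sum of the [x ^+ i] for [i < n], and each of these [n]
    powers is at least [x ^+ n]. *)
Lemma linear_geometric_bound (x : R) n : 0 <= x < 1 ->
  (1 - x) * (n%:R * x ^+ n) <= 1 - x ^+ n.
Proof.
move=> /andP[x0 x1]; elim: n => [|n IHn]; first by rewrite mul0r mulr0 expr0 subrr.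
have xn1 : x ^+ n <= 1 by rewrite exprn_ile1 // ltW.
have xn0 : 0 <= x ^+ n by rewrite exprn_ge0.
have xIHn := ler_wpM2l x0 IHn.
have xxn : x * x ^+ n <= 1 by rewrite mulr_ile1 // ltW.
have : 0 <= (1 - x) * (1 - x * x ^+ n) by rewrite mulr_ge0 ?subr_ge0 // ltW.
by rewrite -natr1 exprS; move: xIHn; lra.
Qed.

(** With [y] halfway between [x] and 1, the bounded sequence [n * (x / y) ^+ n] absorbs one factor
    [n], and induction on [k] applies to [y]. *)
Lemma cvg_monomial_geometric k (x : R) : 0 <= x < 1 ->
  (fun n => n%:R ^+ k * x ^+ n) @ \oo --> (0 : R).
Proof.
elim: k x => [|k IHk] x /andP[x0 x1].
  under eq_fun do rewrite expr0 mul1r.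
  by apply: cvg_expr; rewrite ger0_norm.
pose y := (1 + x) / 2.
have y0 : 0 < y by rewrite /y; lra.
have y01 : 0 <= y < 1 by rewrite /y; apply/andP; split; lra.
have xy : 0 <= x / y < 1.
  apply/andP; split; first by rewrite divr_ge0 // ltW.
  by rewrite ltr_pdivrMr // mul1r /y; lra.
have /(cvgM (cvg_cst (1 - x / y)^-1)) := IHk _ y01; rewrite mulr0 => Hy.
apply: (squeeze_cvgr _ (cvg_cst 0) Hy).
near=> n; rewrite mulr_ge0 ?exprn_ge0 //= /GRing.mul_fun /=.
have := linear_geometric_bound n xy.
set b := 1 - x / y; have b0 : 0 < b by rewrite /b subr_gt0; case/andP: xy.
move=> Hb.
rewrite ler_pdivlMl // exprS.
have -> : x ^+ n = (x / y) ^+ n * y ^+ n by rewrite -exprMn divfK // gt_eqF.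
have -> : b * (n%:R * n%:R ^+ k * ((x / y) ^+ n * y ^+ n)) =
   (b * (n%:R * (x / y) ^+ n)) * (n%:R ^+ k * y ^+ n) by ring.
rewrite ler_piMl ?mulr_ge0 ?exprn_ge0 //; first exact: ltW.
apply: le_trans Hb _; rewrite gerBl exprn_ge0 //; by case/andP: xy.
Unshelve. all: by end_near. Qed.

Lemma poly_over_power_vanishes q D : (size q <= D)%N ->
  vanishes (fun n => q.[n%:R] / n%:R ^+ D).
Proof.
move=> szq.
apply: (@vanishes_ext _ (fun n => \sum_(i <- iota 0 D) q`_i * (n%:R ^+ i / n%:R ^+ D))).
  move=> n; rewrite (horner_coef_wide _ szq) mulr_suml -(big_mkord xpredT (fun i => q`_i * n%:R ^+ i / n%:R ^+ D)).
  by rewrite /index_iota subn0; apply: eq_bigr => i _; rewrite mulrA.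
apply: vanishes_sum => i; rewrite mem_iota add0n /= => iD.
apply: vanishesZ; apply: (@vanishes_le _ _ (fun n => 1 / n%:R)); last exact: cvg_div_nat.
near=> n; have n0 : (0 < n)%N by near: n; exists 1%N.
have nR0 : 0 < (n%:R : R) by rewrite ltr0n.
rewrite normcM normcV !normcX normc_nat -(subnKC iD) addSnnS exprD exprS.
rewrite invfM mulrA divff ?expf_neq0 ?gt_eqF // ler_pM2l // invfM.
rewrite ler_piMr ?invr_ge0 ?(ltW nR0) // invf_le1 ?exprn_gt0 //.
by rewrite exprn_ege1 // ler1n.
Unshelve. all: by end_near. Qed.

Lemma poly_geometric_vanishes q w : normc w < 1 ->
  vanishes (fun n => q.[n%:R] * w ^+ n).
Proof.
move=> w1.
apply: (@vanishes_ext _ (fun n => \sum_(i <- iota 0 (size q)) q`_i * (n%:R ^+ i * w ^+ n))).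
  move=> n; rewrite horner_coef mulr_suml -(big_mkord xpredT (fun i => q`_i * n%:R ^+ i * w ^+ n)).
  by rewrite /index_iota subn0; apply: eq_bigr => i _; rewrite mulrA.
apply: vanishes_sum => i _; apply: vanishesZ.
apply: (@vanishes_le _ _ (fun n => n%:R ^+ i * normc w ^+ n)).
  by near=> n; rewrite normcM !normcX normc_nat.
by apply: cvg_monomial_geometric; rewrite normc_ge0 w1.
Unshelve. all: by end_near. Qed.

Lemma bounded_inv_power D : bounded_seq (fun n => (n%:R ^+ D : R[i])^-1).
Proof.
exists 1 => n; rewrite normcV normcX normc_nat.
(* At [n = 0] the power is 1 or 0, and the inverse of 0 is 0. *)
case: n => [|n]; first by case: D => [|D]; rewrite ?expr0 ?invr1 // expr0n invr0 ler01.
by rewrite invf_le1 ?exprn_gt0 ?ltr0n // exprn_ege1 // ler1n.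
Qed.

(** Here [rho] is the largest modulus, [D] the largest degree among the bases of that modulus, and
    [t1] collects the bases attaining both. *)
Lemma leading_part_unscaled (F : nat -> R[i]) (t : seq R[i]) (P : R[i] -> {poly R[i]}) :
  normal_form F t P -> t != [::] ->
  exists (rho : R) (D : nat) (t1 : seq R[i]),
  [/\ 0 < rho, {in t, forall z, normc z <= rho}, t1 != [::], uniq t1 &
   [/\ {subset t1 <= t}, {in t1, forall z, normc z = rho} &
    vanishes (fun n => F n / (rho%:C ^+ n * n%:R ^+ D)
                       - \sum_(z <- t1) lead_coef (P z) * (z / rho%:C) ^+ n)]].
Proof.
move=> [t_uniq t0 P0 HF] tN0.
have [z0 z0t z0max] := seq_argmax (fun z : R[i] => normc z : R) tN0.
pose rho := normc z0.
have [|z1] := @seq_argmax _ _ _ (fun z => (size (P z)).-1) [seq z <- t | normc z == rho].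
  by rewrite -has_filter; apply/hasP; exists z0.
rewrite mem_filter => /andP[/eqP z1rho z1t] z1max.
pose D := (size (P z1)).-1.
pose lead z := (normc z == rho) && ((size (P z)).-1 == D).
have rho0 : 0 < rho by rewrite normc_gt0; apply: contraNneq t0 => <-.
have rhoC0 : rho%:C != 0 by rewrite (inj_eq (@complexI R) _ 0) gt_eqF.
exists rho, D, [seq z <- t | lead z]; split => //.
- by rewrite -has_filter; apply/hasP; exists z1; rewrite // /lead z1rho !eqxx.
- exact: filter_uniq.
split.
- by move=> z; rewrite mem_filter => /andP[].
- by move=> z; rewrite mem_filter => /andP[/andP[/eqP]].
(* The difference is split along [t]; a summand tends to 0 because its base is smaller than [rho],
   or its degree is below [D], or its leading term is subtracted. *)
apply: (@vanishes_ext _ (fun n => \sum_(z <- t)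
   ((P z).[n%:R] * (z / rho%:C) ^+ n / n%:R ^+ D
     - (if lead z then lead_coef (P z) else 0) * (z / rho%:C) ^+ n))).
  move=> n; rewrite sumrB big_filter [in RHS]big_mkcond HF mulr_suml; congr (_ - _).
    by apply: eq_bigr => z _; rewrite expr_div_n invfM; ring.
  by apply: eq_bigr => z _; case: ifP; rewrite ?mul0r.
apply: vanishes_sum => z zt.
have := z0max z zt; rewrite -/rho le_eqVlt => /predU1P[zrho|zrho]; last first.
  rewrite /lead lt_eqF //=.
  have w1 : normc (z / rho%:C) < 1.
    by rewrite normcM normcV normc_real gtr0_norm // ltr_pdivrMr // mul1r.
  have := vanishes_bounded_mul (bounded_inv_power D) (poly_geometric_vanishes (P z) w1).
  by apply: vanishes_ext => n; rewrite mul0r subr0 mulrC.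
have wb : bounded_seq (fun n => (z / rho%:C) ^+ n).
  by exists 1 => n; rewrite normcX normcM normcV normc_real gtr0_norm // zrho divff ?gt_eqF // expr1n.
have szP : ((size (P z)).-1 <= D)%N.
  by have := z1max z; rewrite mem_filter zrho eqxx zt leEnat; apply.
have sPz : (0 < size (P z))%N by rewrite size_poly_gt0 P0.
rewrite /lead zrho eqxx /=; case: eqP => [szD|szD]; last first.
  have szPD : (size (P z) <= D)%N by rewrite -(prednK sPz) ltn_neqAle szP andbT; apply/eqP.
  have := vanishes_bounded_mul wb (poly_over_power_vanishes szPD).
  by apply: vanishes_ext => n; ring.
pose q := P z - lead_coef (P z) *: 'X^D.
have szq : (size q <= D)%N.
  apply/leq_sizeP => j Dj; rewrite coefB coefZ coefXn.
  have [->|jD] := eqVneq j D; first by rewrite lead_coefE szD mulr1 subrr.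
  by rewrite mulr0 subr0 nth_default // -(prednK sPz) szD ltn_neqAle eq_sym jD.
have := vanishes_bounded_mul wb (poly_over_power_vanishes szq).
apply: vanishes_le; near=> n.
have n0 : (n%:R ^+ D : R[i]) != 0.
  by rewrite expf_neq0 // pnatr_eq0 -lt0n; near: n; exists 1%N.
rewrite le_eqVlt; apply/orP; left; apply/eqP; congr normc.
rewrite /q hornerD hornerN hornerZ hornerXn.
by move: ((z / rho%:C) ^+ n) (n%:R ^+ D) n0 => w d d0; field.
Unshelve. all: by end_near. Qed.

(** Dividing the selected bases by [rho] puts the frequencies on the unit circle. *)
Lemma leading_part (F : nat -> R[i]) (t : seq R[i]) (P : R[i] -> {poly R[i]}) :
  normal_form F t P -> t != [::] ->
  exists (rho : R) (D : nat) (t1 : seq R[i]) (c : R[i] -> R[i]),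
  [/\ 0 < rho, {in t, forall z, normc z <= rho}, {in t1, forall z, z * rho%:C \in t} &
   [/\ t1 != [::], uniq t1, {in t1, forall z, normc z = 1}, {in t1, forall z, c z != 0} &
    vanishes (fun n => F n / (rho%:C ^+ n * n%:R ^+ D) - \sum_(z <- t1) c z * z ^+ n)]].
Proof.
move=> nf tN0.
have [rho [D [t1 [rho0 trho t1N0 t1_uniq [t1t t1rho lead]]]]] := leading_part_unscaled nf tN0.
have rhoC0 : rho%:C != 0 by rewrite (inj_eq (@complexI R) _ 0) gt_eqF.
have divI : injective (fun z => z / rho%:C).
  by move=> z w /= /(congr1 (fun u => u * rho%:C)); rewrite !divfK.
exists rho, D, [seq z / rho%:C | z <- t1], (fun z => lead_coef (P (z * rho%:C))); split=> //.
  by move=> _ /mapP[z zt1 ->]; rewrite divfK // t1t.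
split.
- by case: (t1) t1N0.
- by rewrite map_inj_uniq.
- move=> _ /mapP[z zt1 ->].
  by rewrite normcM normcV normc_real (t1rho _ zt1) gtr0_norm // divff // gt_eqF.
- move=> _ /mapP[z zt1 ->]; rewrite divfK // lead_coef_eq0.
  by case: nf => _ _ P0 _; apply: P0; exact: t1t.
apply: vanishes_ext lead => n; rewrite big_map; congr (_ - _).
by apply: eq_bigr => z _; rewrite divfK.
Qed.

End LeadingPart.

(** * Rarity of small values of a trigonometric polynomial *)

Section SmallValues.

(** Each point of [I] claims itself and the [H] positions after it; the summand [H] pays for the
    last block, which may stick out of the window. *)
Lemma count_spaced (I : pred nat) H m N :
  (forall n h, I n -> (1 <= h <= H)%N -> ~~ I (n + h)%N) ->
  (H * count I (iota m N) <= N + H)%N.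
Proof.
move=> Isep; have [k] := ubnP N; elim: k m N => // k IHk m [_|N ltNk]; first by rewrite muln0.
have count0 L : (L <= H)%N -> count I (iota m.+1 L) = 0%N \/ ~~ I m.
  move=> LH; case Im: (I m); last by right.
  left; apply/eqP; rewrite -leqn0 leqNgt -has_count; apply/hasPn => n.
  rewrite mem_iota => /andP[mn nL].
  have -> : (n = m + (n - m))%N by lia.
  by apply: Isep => //; lia.
have [Im|NIm] := boolP (I m); last first.
  rewrite /= (negbTE NIm) add0n; apply: leq_trans (IHk m.+1 N _) _; lia.
have {}count0 L : (L <= H)%N -> count I (iota m.+1 L) = 0%N.
  by move=> /count0[//|]; rewrite Im.
rewrite /= Im; have [NH|HN] := leqP N H; first by rewrite count0 // addn0 muln1; lia.
have -> : N = (H + (N - H))%N by lia.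
rewrite iotaD count_cat count0 // add0n mulnDr muln1.
have lt_k : (N - H < k)%N by lia.
have := IHk (m.+1 + H)%N (N - H)%N lt_k; lia.
Qed.

Lemma count_sum (P : pred nat) (s : seq nat) : count P s = (\sum_(n <- s) P n)%N.
Proof. by rewrite -sum1_count big_mkcond; apply: eq_bigr => n _; case: (P n). Qed.

Lemma count_pairs_bound (A : pred nat) H N :
  (H * count A (iota 0 N) <= N + H +
     H * \sum_(h <- iota 1 H) count (fun n => A n && A (n + h)) (iota 0 N))%N.
Proof.
(* [I] keeps the points of [A] with no other point of [A] among the next [H]. It is spaced; any
   other point of [A] is counted in one of the pair sums. *)
pose I n := A n && ~~ has (fun h => A (n + h)%N) (iota 1 H).
have Isep n h : I n -> (1 <= h <= H)%N -> ~~ I (n + h)%N.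
  move=> /andP[_ /hasPn HI] hH; rewrite negb_and HI // mem_iota; lia.
apply: leq_trans (leq_add (count_spaced 0 N Isep) (leqnn _)).
rewrite -mulnDr leq_mul2l; apply/orP; right.
under eq_bigr do rewrite count_sum.
rewrite exchange_big /= !count_sum -big_split /=; apply: leq_sum => n _.
case An: (A n) => //; rewrite /I An /=; case: hasP => // -[h hH Anh].
by rewrite (bigD1_seq h) ?iota_uniq //= Anh.
Qed.

Variable R : realType.
Implicit Types (z w : R[i]) (t : seq R[i]).
Local Notation normc := ComplexField.Normc.normc.

Lemma common_threshold (g : nat -> nat -> R[i]) (k : nat) (hs : seq nat) :
  {in hs, forall h, exists2 e : R, 0 < e & exists N0, forall N, (N0 <= N)%N ->
    (k * count (fun n => normc (g h n) < e)%R (iota 0 N) <= N)%N} ->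
  exists2 e : R, 0 < e & exists N0, {in hs, forall h N, (N0 <= N)%N ->
    (k * count (fun n => normc (g h n) < e)%R (iota 0 N) <= N)%N}.
Proof.
elim: hs => [_|h hs IHhs Hg]; first by exists 1 => //; exists 0%N.
have [|e e0 [N0 HN0]] := IHhs.
  by move=> j jhs; apply: Hg; rewrite in_cons jhs orbT.
have [|e' e'0 [N0' HN0']] := Hg h; first exact: mem_head.
have mono (e1 e2 : R) j N : e1 <= e2 ->
    (k * count (fun n => normc (g j n) < e1)%R (iota 0 N) <=
     k * count (fun n => normc (g j n) < e2)%R (iota 0 N))%N.
  move=> e12; rewrite leq_mul2l; apply/orP; right; apply: sub_count => n /= lt1.
  exact: lt_le_trans lt1 e12.
exists (Num.min e e'); first by rewrite lt_min e0.
exists (maxn N0 N0') => j; rewrite in_cons => /predU1P[->|jhs] N; rewrite geq_max => /andP[N1 N2].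
  by apply: leq_trans (mono _ e' _ _ _) (HN0' _ N2); rewrite ge_min lexx orbT.
by apply: leq_trans (mono _ e _ _ _) (HN0 _ jhs _ N1); rewrite ge_min lexx.
Qed.

(* Induction on the number of frequencies: n |-> g (n + h) - w ^+ h * g n loses
   the frequency w, and it is small wherever both g n and g (n + h) are. *)
Lemma nondegenerate_trig_rarely_small t (c : R[i] -> R[i]) k :
  t != [::] -> uniq t -> {in t, forall z, normc z = 1} ->
  {in t &, forall z w j, (0 < j)%N -> z ^+ j = w ^+ j -> z = w} ->
  {in t, forall z, c z != 0} ->
  exists2 e : R, 0 < e & exists N0, forall N, (N0 <= N)%N ->
    (k * count (fun n => normc (\sum_(z <- t) c z * z ^+ n) < e)%R (iota 0 N) <= N)%N.
Proof.
elim: t c k => // w t IHt c k _ /andP[wt t_uniq] t1 nd c0.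
have w1 : normc w = 1 by apply: t1; exact: mem_head.
(* A single frequency has constant modulus [normc (c w)], so no value is strictly below it. *)
have [tN|tN0] := eqVneq t [::].
  exists (normc (c w)); first by rewrite normc_gt0 c0 // mem_head.
  exists 0%N => N _; rewrite (eq_count (a2 := pred0)) ?count_pred0 ?muln0 // => n /=.
  by rewrite tN big_seq1 normcM normcX w1 expr1n mulr1 ltxx.
case: k => [|k]; first by exists 1 => //; exists 0%N.
(* The final bound on [H * count] has three summands, each at most [N]; the 3 compensates for
   them. *)
pose H := (3 * k.+1)%N.
pose g n := \sum_(z <- w :: t) c z * z ^+ n.
pose gh h n := \sum_(z <- t) (c z * (z ^+ h - w ^+ h)) * z ^+ n.
have ghE h n : gh h n = g (n + h)%N - w ^+ h * g n.
  rewrite /g !big_cons mulrDr opprD addrACA exprD.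
  rewrite [X in _ = X + _](_ : _ = 0) ?add0r; last ring.
  by rewrite mulr_sumr -sumrB; apply: eq_bigr => z _; rewrite exprD; ring.
(* One factor [H] is spent on summing over the [H] shifts, the other remains in [H * S <= N]. *)
have [|e e0 [N0 HN0]] := @common_threshold gh (H * H)%N (iota 1 H).
  move=> h; rewrite mem_iota => /andP[h1 _]; apply: IHt => //.
  - by move=> z zt; apply: t1; rewrite in_cons zt orbT.
  - by move=> z y zt yt; apply: nd; rewrite in_cons ?zt ?yt orbT.
  (* The new coefficients are nonzero by nondegeneracy: [z ^+ h = w ^+ h] would force [z = w], but
     [w] is not in [t]. *)
  - move=> z zt; rewrite mulf_neq0 ?c0 ?in_cons ?zt ?orbT // subr_eq0.
    apply: contraNneq wt => zw; rewrite -(nd z w _ _ h h1 zw) ?mem_head //.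
    by rewrite in_cons zt orbT.
exists (e / 2); first by rewrite divr_gt0.
exists (maxn N0 H) => N; rewrite geq_max => /andP[N0N HN].
pose A n := normc (g n) < e / 2.
have := count_pairs_bound A H N; rewrite -/(g _).
set S := (\sum_(h <- _) _)%N; move=> bound.
have SN : (H * S <= N)%N.
  have HS : (H * H * S <= H * N)%N.
    rewrite /S big_distrr /=; apply: leq_trans (_ : (\sum_(h <- iota 1 H) N <= _)%N).
      rewrite big_seq [leqRHS]big_seq; apply: leq_sum => h hH.
      apply: leq_trans (HN0 _ hH _ N0N); rewrite leq_mul2l; apply/orP; right.
      apply: sub_count => n /andP[An Anh] /=; rewrite ghE.
      apply: le_lt_trans (normcD _ _) _; rewrite normcN normcM normcX w1 expr1n mul1r.
      by rewrite [e]splitr ltrD.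
    by rewrite big_const_seq count_predT size_iota iter_addn_0 mulnC.
  by move: HS; rewrite -mulnA leq_mul2l.
change (k.+1 * count A (iota 0 N) <= N)%N.
move: bound SN HN; rewrite /H; move: (count _ _) => a; nia.
Qed.

End SmallValues.

(** * Real averages and polynomial approximation of a step *)

Section Averages.
Variable R : realType.
Implicit Types (a b : nat -> R).

Lemma cvg_avg a (l : R) : a @ \oo --> l -> avg a @ \oo --> l.
Proof.
move=> /cesaro al; rewrite -cvg_shiftS.
suff -> : [sequence avg a n.+1]_n = arithmetic_mean a by [].
by apply/funext => N; rewrite /= /arithmetic_mean /avg /series /= big_mkord mulrC.
Qed.

Lemma avgD a b N : avg (fun n => a n + b n) N = avg a N + avg b N.
Proof. by rewrite /avg big_split mulrDl. Qed.

Lemma avgZ (k : R) a N : avg (fun n => k * a n) N = k * avg a N.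
Proof. by rewrite /avg -mulr_sumr mulrA. Qed.

Lemma avgB a b N : avg (fun n => a n - b n) N = avg a N - avg b N.
Proof. by rewrite /avg sumrB mulrBl. Qed.

Lemma avg_cst (k : R) N : (0 < N)%N -> avg (fun=> k) N = k.
Proof.
move=> N0; rewrite /avg sumr_const card_ord -[k *+ N]mulr_natr mulfK //.
by rewrite pnatr_eq0 -lt0n.
Qed.

Lemma ler_avg a b N : (forall n, a n <= b n) -> avg a N <= avg b N.
Proof. by move=> ab; rewrite ler_wpM2r ?invr_ge0 // ler_sum. Qed.

Lemma normr_avg a N : `|avg a N| <= avg (fun n => `|a n|) N.
Proof.
rewrite /avg normrM [`|N%:R^-1|]ger0_norm ?invr_ge0 //.
by rewrite ler_wpM2r ?invr_ge0 // ler_norm_sum.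
Qed.

Lemma avg_count (P : pred nat) N :
  avg (fun n => (P n)%:R) N = (count P (iota 0 N))%:R / N%:R :> R.
Proof.
rewrite /avg count_sum natr_sum -(big_mkord xpredT (fun n => (P n)%:R : R)).
by rewrite /index_iota subn0.
Qed.

Lemma avg_near_eq a b (l : R) : (\forall n \near \oo, a n = b n) ->
  avg a @ \oo --> l -> avg b @ \oo --> l.
Proof.
move=> ab al; have ba0 : (fun n => b n - a n) @ \oo --> (0 : R).
  apply: (cvg_near_cst (U := R)); near=> n.
  by rewrite (_ : a n = b n) ?subrr //; near: n.
have -> : avg b = (fun N => avg a N + avg (fun n => b n - a n) N).
  by apply/funext => N; rewrite avgB addrC subrK.
by rewrite -[l]addr0; apply: cvgD => //; exact: cvg_avg.
Unshelve. all: by end_near. Qed.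

(** Such a sequence is Cauchy, so convergence follows without a candidate for the limit. *)
Lemma cvg_approx a :
  (forall e, 0 < e -> exists2 b, cvgn b & \forall n \near \oo, `|a n - b n| <= e) ->
  cvgn a.
Proof.
move=> H; apply: cauchy_cvg; apply: cauchy_exP => e e0.
have [|b /cvg_ex[l /= bl] ab] := H (e / 2); first by rewrite divr_gt0.
exists l; near=> n; rewrite /ball /= distrC.
rewrite (_ : a n - l = (a n - b n) + (b n - l)); last by ring.
apply: le_lt_trans (ler_normD _ _) _; rewrite [e]splitr; apply: ler_ltD.
  by near: n.
rewrite distrC; near: n; move/cvgrPdist_lt: bl; apply; exact: divr_gt0.
Unshelve. all: by end_near. Qed.

Lemma sum_residues a M q :
  \sum_(n < M * q) a n = \sum_(b < M) \sum_(j < q) a (M * j + b)%N.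
Proof.
rewrite exchange_big /= -(big_mkord xpredT a).
elim: q => [|q IHq]; first by rewrite muln0 big_nil big_ord0.
by rewrite big_ord_recr mulnS addnC big_mkord big_split_ord /= -IHq big_mkord.
Qed.

(** At [N] the average differs from the mean of the [M] averages along residue classes, taken at
    [N %/ M], by at most [2 * M / N]. *)
Lemma cvg_avg_residues a M : (0 < M)%N -> (forall n, `|a n| <= 1) ->
  (forall i, (i < M)%N -> cvgn (avg (fun n => a (M * n + i)%N))) ->
  cvgn (avg a).
Proof.
move=> M0 a1 Ha; have MR0 : 0 < M%:R :> R by rewrite ltr0n.
pose S q := \sum_(b < M) avg (fun n => a (M * n + b)%N) q.
have Scvg : cvgn S.
  rewrite /S; elim: (index_enum 'I_M) => [|i r IHr].
    by apply/cvg_ex; exists 0; under eq_fun do rewrite big_nil; exact: cvg_cst.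
  under eq_fun do rewrite big_cons.
  exact: is_cvgD (Ha i (ltn_ord i)) IHr.
have SM q : `|S q| <= M%:R.
  apply: le_trans (ler_norm_sum _ _ _) _.
  rewrite -[leRHS]mulr1 mulr_natl -[X in _ *+ X]card_ord -sumr_const.
  apply: ler_sum => b _; apply: le_trans (normr_avg _ _) _.
  case: q => [|q]; first by rewrite /avg big_ord0 mul0r.
  by rewrite -[leRHS](@avg_cst 1 q.+1) //; apply: ler_avg.
apply: cvg_approx => e e0.
exists (fun N => M%:R^-1 * S (N %/ M)%N).
  have divM : (fun N => (N %/ M)%N) @ \oo --> \oo.
    move=> A [n0 _ HA]; exists (n0 * M)%N => // N /= MN; apply: HA => /=.
    by rewrite leq_divRL.
  have /cvg_ex[l /= Sl] := Scvg; apply/cvg_ex; exists (M%:R^-1 * l).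
  have Sdiv : (fun N => S (N %/ M)%N) @ \oo --> l by exact: cvg_comp divM Sl.
  by apply: cvgM => //; exact: cvg_cst.
near=> N; have N0 : (0 < N)%N by near: N; exists 1%N.
pose q := (N %/ M)%N.
have qS : \sum_(n < M * q) a n = q%:R * S q.
  rewrite sum_residues /S mulr_sumr; apply: eq_bigr => b _; rewrite /avg.
  case: (q) => [|p]; first by rewrite big_ord0 !mul0r.
  by rewrite mulrC divfK // pnatr_eq0.
have NE : N = (M * q + N %% M)%N by rewrite mulnC; exact: divn_eq.
have lt_r : (N %% M < M)%N by rewrite ltn_pmod.
have sumE : \sum_(n < N) a n = q%:R * S q + \sum_(i < N %% M) a (M * q + i)%N.
  by rewrite -qS -(big_mkord xpredT a) {1}NE big_mkord big_split_ord.
have tail : `|\sum_(i < N %% M) a (M * q + i)%N| <= M%:R.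
  apply: le_trans (ler_norm_sum _ _ _) _.
  apply: (@le_trans _ _ (\sum_(i < N %% M) 1)); first by apply: ler_sum.
  by rewrite sumr_const card_ord ler_nat ltnW.
have NR0 : 0 < N%:R :> R by rewrite ltr0n.
(* Both terms of the numerator are at most [M] in absolute value: the tail has fewer than [M]
   entries, and [S q] is bounded by [M]. *)
have diffE : avg a N - M%:R^-1 * S q =
    (\sum_(i < N %% M) a (M * q + i)%N - (N %% M)%:R / M%:R * S q) / N%:R.
  rewrite /avg sumE; have -> : (N%:R : R) = M%:R * q%:R + (N %% M)%:R.
    by rewrite {1}NE natrD natrM.
  field.
  by rewrite -natrM -natrD -NE !pnatr_eq0 -!lt0n M0 N0.
rewrite -/q diffE normrM [`|_^-1|]gtr0_norm ?invr_gt0 //.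
apply: (@le_trans _ _ ((2 * M%:R) / N%:R)).
  rewrite ler_wpM2r ?invr_ge0 //; apply: le_trans (ler_normB _ _) _.
  rewrite (_ : 2 * M%:R = M%:R + M%:R :> R); last by ring.
  rewrite lerD // normrM -[leRHS]mul1r ler_pM //.
  rewrite ger0_norm ?divr_ge0 // ler_pdivrMr // mul1r ler_nat; exact: ltnW.
near: N; have /cvgrPdist_le/(_ e e0) := cvg_div_nat (2 * M%:R : R).
by apply: filterS => N; rewrite sub0r normrN ger0_norm // divr_ge0 // mulr_ge0.
Unshelve. all: by end_near. Qed.

Lemma bernoulli_ineq (x : R) n : -1 <= x -> 1 + n%:R * x <= (1 + x) ^+ n.
Proof.
move=> x1; elim: n => [|n IHn]; first by rewrite mul0r addr0.
have x10 : 0 <= 1 + x by lra.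
have := ler_wpM2l x10 IHn; rewrite -exprS; apply: le_trans.
have n0 : 0 <= n%:R :> R by [].
have := mulr_ge0 n0 (sqr_ge0 x); rewrite -natr1; nra.
Qed.

(* Brosowski and Deutsch's polynomials; both estimates come from Bernoulli's
   inequality, for 1 - x ^+ m and for 1 + x ^+ m respectively. *)
Lemma step_approximation (d e : R) : 0 < d -> 0 < e ->
  exists m, forall x, 0 <= x <= 1 ->
    [/\ 0 <= (1 - x ^+ m) ^+ (2 ^ m) <= 1,
        x <= 2^-1 - d -> 1 - e <= (1 - x ^+ m) ^+ (2 ^ m) &
        2^-1 + d <= x -> (1 - x ^+ m) ^+ (2 ^ m) <= e].
Proof.
(* Then [2 * x <= y] when [x <= 2^-1 - d], since [1 - 2 * d <= y], and [1 <= y * (2 * x)] when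
   [2^-1 + d <= x]; so [y ^+ m] bounds both errors. *)
move=> d0 e0; pose y := (1 + 2 * d)^-1.
have y0 : 0 < y by rewrite invr_gt0; lra.
have yd : y * (1 + 2 * d) = 1 by rewrite mulVf // gt_eqF; lra.
have y1 : y < 1 by nra.
have [m ym] : exists m, y ^+ m <= e.
  have /cvgrPdist_le/(_ e e0)[m _ Hm] : (fun n => y ^+ n) @ \oo --> (0 : R).
    by apply: cvg_expr; rewrite gtr0_norm.
  exists m; have := Hm m (leqnn m).
  by rewrite sub0r normrN ger0_norm // exprn_ge0 // ltW.
exists m => x /andP[x0 x1].
have xm0 : 0 <= x ^+ m by rewrite exprn_ge0.
have xm1 : x ^+ m <= 1 by rewrite exprn_ile1.
have q0 : 0 <= (1 - x ^+ m) ^+ (2 ^ m) by rewrite exprn_ge0 // subr_ge0.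
have pow2 : (2 ^ m)%:R * x ^+ m = (2 * x) ^+ m :> R by rewrite natrX exprMn.
split.
- by rewrite q0 exprn_ile1 ?subr_ge0 // gerBl.
- move=> xd; apply: le_trans (bernoulli_ineq (2 ^ m) _); last by rewrite lerN2.
  rewrite mulrN pow2 lerD2l lerN2; apply: le_trans _ ym.
  by rewrite lerXn2r ?nnegrE ?mulr_ge0 // ?ltW //; nra.
move=> dx; have B := bernoulli_ineq (2 ^ m) (le_trans (lerN10 R) xm0).
apply: le_trans _ ym.
(* The product of the two bases is [1 - x ^+ (2 * m)], at most 1; with [B] this bounds the step by
   the inverse of [(2 * x) ^+ m]. *)
have le1 : (1 - x ^+ m) ^+ (2 ^ m) * (1 + x ^+ m) ^+ (2 ^ m) <= 1.
  by rewrite -exprMn exprn_ile1 //; nra.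
have yx : 1 <= y ^+ m * (2 * x) ^+ m by rewrite -exprMn exprn_ege1 //; nra.
rewrite pow2 in B.
have ym0 : 0 <= y ^+ m by rewrite exprn_ge0 // ltW.
have h1 : (1 - x ^+ m) ^+ (2 ^ m) * (2 * x) ^+ m <= 1.
  apply: le_trans le1; rewrite ler_wpM2l //; lra.
have := ler_wpM2l ym0 h1; have := ler_wpM2l q0 yx; lra.
Qed.

End Averages.

(** * Existence of the density of the positive set *)

Section SignDensity.
Variable R : realType.
Implicit Types (r f : nat -> R) (t : seq R[i]) (c : R[i] -> R[i]).
Local Notation normc := ComplexField.Normc.normc.

Definition trig_terms t c := [seq (c z, z) | z <- t].

Lemma trig_termsE t c n : trig (trig_terms t c) n = \sum_(z <- t) c z * z ^+ n.
Proof. by rewrite /trig big_map. Qed.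

Lemma unimodular_trig_terms t c : {in t, forall z, normc z = 1} ->
  unimodular (trig_terms t c).
Proof. by move=> t1; apply/allP => _ /mapP[z zt ->]; rewrite t1. Qed.

Lemma asymp_trig_real_bound r : asymp_trig (fun n => (r n)%:C) ->
  exists2 B, 0 < B & forall n, `|r n| <= B.
Proof.
move=> /asymp_trig_bounded[B HB]; exists (`|B| + 1); first by rewrite ltr_wpDl.
move=> n; rewrite -normc_real; apply: le_trans (HB n) _.
by apply: le_trans (ler_norm B) _; rewrite lerDl.
Qed.

(** This decreasing affine map sends 0 to 1/2, so positive values land on the side where the step
    polynomial is close to 1. *)
Lemma rescale_bounds (a B : R) : 0 < B -> `|a| <= B -> 0 <= (1 - a / B) / 2 <= 1.
Proof.
move=> B0; rewrite ler_norml => /andP[aB1 aB2].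
have aBl : -1 <= a / B by rewrite ler_pdivlMr // mulN1r.
have aBr : a / B <= 1 by rewrite ler_pdivrMr // mul1r.
by apply/andP; split; lra.
Qed.

(** Three cases. If [g < eps], the trivial error 1 is paid by the indicator. If [g >= eps] but [a]
    is below [eps / 2] in absolute value, then [d] exceeds [eps / 2] and its term pays. Otherwise
    [a] is outside the transition zone, whose half-width [eps / (4 * B)] is [eps / 2] after
    rescaling. *)
Lemma step_error (a B eps e v g d : R) : 0 < B -> 0 < eps -> 0 <= e ->
  0 <= v <= 1 ->
  ((1 - a / B) / 2 <= 2^-1 - eps / (4 * B) -> 1 - e <= v) ->
  (2^-1 + eps / (4 * B) <= (1 - a / B) / 2 -> v <= e) ->
  0 <= d -> g <= `|a| + d ->
  `|(0 < a)%R%:R - v| <= e + ((g < eps)%R%:R + 2 / eps * d).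
Proof.
move=> B0 eps0 e0 /andP[v0 v1] vlow vhigh d0 gad.
have d1 : 0 <= 2 / eps * d by rewrite mulr_ge0 // divr_ge0 // ltW.
have le1 : `|(0 < a)%R%:R - v| <= 1.
  by rewrite ler_norml; case: (0 < a); rewrite ?mulr1n ?mulr0n; apply/andP; split; lra.
have [gs|gl] := ltP g eps; first by rewrite mulr1n; lra.
rewrite mulr0n add0r; have [rs|rl] := ltP `|a| (eps / 2).
  have : 1 <= 2 / eps * d by rewrite mulrAC ler_pdivlMr // mul1r; lra.
  lra.
have halfE : eps / (4 * B) = eps / 2 / B / 2 by field; rewrite gt_eqF.
have [a0|a0] := ltP 0 a.
  rewrite gtr0_norm // in rl.
  have : 1 - e <= v.
    apply: vlow; rewrite halfE.
    have : eps / 2 / B <= a / B by rewrite ler_pM2r ?invr_gt0.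
    by clear; lra.
  by rewrite mulr1n ger0_norm ?subr_ge0 //; lra.
rewrite ler0_norm // in rl.
have : v <= e.
  apply: vhigh; rewrite halfE.
  have : eps / 2 / B <= - a / B by rewrite ler_pM2r ?invr_gt0.
  by rewrite mulNr; clear; lra.
by rewrite mulr0n sub0r normrN ger0_norm //; lra.
Qed.

(** The indicator is close on average to [v], a polynomial in [r], which has a mean. The step error,
    the rare small values of [g] and the deviation of [r] from [g] cost at most [e / 4] each. *)
Lemma trig_sign_density r t c :
  t != [::] -> uniq t -> {in t, forall z, normc z = 1} ->
  {in t &, forall z w j, (0 < j)%N -> z ^+ j = w ^+ j -> z = w} ->
  {in t, forall z, c z != 0} ->
  vanishes (fun n => (r n)%:C - \sum_(z <- t) c z * z ^+ n) ->
  cvgn (avg (fun n => (0 < r n)%R%:R : R)).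
Proof.
move=> tN0 t_uniq t1 nd c0 rg.
have r_trig : asymp_trig (fun n => (r n)%:C).
  exists (trig_terms t c); first exact: unimodular_trig_terms.
  by apply: vanishes_ext rg => n; rewrite trig_termsE.
have [B B0 rB] := asymp_trig_real_bound r_trig.
apply: cvg_approx => e e0.
(* Small values then have frequency at most [1 / k], which is below [e / 4]. *)
pose k := Num.bound (4 / e).
have ke : 4 / e < k%:R by apply: archi_boundP; rewrite divr_ge0 // ltW.
have [eps eps0 [N0 HN0]] := nondegenerate_trig_rarely_small k tN0 t_uniq t1 nd c0.
pose g n := \sum_(z <- t) c z * z ^+ n.
pose dl n := normc ((r n)%:C - g n).
have d0 : 0 < eps / (4 * B) by rewrite divr_gt0 // mulr_gt0.
have e40 : 0 < e / 4 by rewrite divr_gt0.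
have [m Hm] := step_approximation d0 e40.
pose x n := (1 - r n / B) / 2.
pose v n := (1 - x n ^+ m) ^+ (2 ^ m).
have v_trig : asymp_trig (fun n => (v n)%:C).
  have -> : (fun n => (v n)%:C) =
     (fun n => (1 + (-1) * (2^-1%:C + (- (2 * B)^-1)%:C * (r n)%:C) ^+ m) ^+ (2 ^ m)).
    apply/funext => n.
    have -> : 2^-1%:C + (- (2 * B)^-1)%:C * (r n)%:C = (x n)%:C.
      rewrite -rmorphM -rmorphD /= /x; apply: (congr1 (real_complex R)).
      by field; rewrite gt_eqF.
    by rewrite /v rmorphXn rmorphB rmorph1 rmorphXn mulN1r.
  apply: asymp_trigX; apply: asymp_trigD; first exact: asymp_trig_cst.
  apply: asymp_trigM; first exact: asymp_trig_cst.
  apply: asymp_trigX; apply: asymp_trigD; first exact: asymp_trig_cst.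
  by apply: asymp_trigM => //; exact: asymp_trig_cst.
have [l /mean_to_avg vl] := asymp_trig_mean v_trig.
exists (avg v); first by apply/cvg_ex; exists (complex.Re l).
have pointwise n : `|(0 < r n)%R%:R - v n| <=
    e / 4 + ((normc (g n) < eps)%R%:R + 2 / eps * dl n).
  have x01 : 0 <= x n <= 1 by exact: rescale_bounds.
  have [v01 vlow vhigh] := Hm _ x01.
  apply: (step_error B0) => //; first exact: ltW.
  - exact: normc_ge0.
  - rewrite -normc_real {1}(_ : g n = (r n)%:C + - ((r n)%:C - g n)); last by ring.
    by apply: le_trans (normcD _ _) _; rewrite normcN.
(* The average of [dl] will be pushed below this value, so that the factor [2 / eps] leaves
   [e / 4]. *)
have eps40 : 0 < eps * e / 8 by rewrite !mulr_gt0.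
near=> N.
have N1 : (0 < N)%N by near: N; exists 1%N.
rewrite -avgB; apply: le_trans (normr_avg _ _) _.
apply: le_trans (ler_avg _ pointwise) _; rewrite !avgD avg_cst // avgZ avg_count.
have cnt : (count (fun n => normc (g n) < eps)%R (iota 0 N))%:R / N%:R <= e / 4.
  rewrite ler_pdivrMr ?ltr0n //.
  have : (k * count (fun n => normc (g n) < eps)%R (iota 0 N) <= N)%N.
    by apply: HN0; near: N; exists N0.
  rewrite -(ler_nat R) natrM; set q := (count _ _)%:R => kq.
  have q0 : 0 <= q :> R by [].
  have : 4 / e * q <= N%:R by apply: le_trans kq; rewrite ler_wpM2r // ltW.
  by rewrite mulrAC ler_pdivrMr //; clear; lra.
have : 2 / eps * avg dl N <= e / 4.
  have : avg dl N <= eps * e / 8.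
    near: N; have /cvgrPdist_le/(_ _ eps40) := cvg_avg rg.
    by apply: filterS => N; rewrite sub0r normrN => /(le_trans (ler_norm _)).
  by move=> H; rewrite mulrAC ler_pdivrMr //; move: H; clear; lra.
by move: cnt e0; clear; lra.
Unshelve. all: by end_near. Qed.

(** Along each residue class modulo [M] the frequencies are nondegenerate, and dividing by the
    positive dominating scale preserves signs. *)
Lemma exp_poly_sign_density f : is_exp_poly (fun n => (f n)%:C) ->
  cvgn (avg (fun n => (0 < f n)%R%:R : R)).
Proof.
case=> s s0 Hs; have sN0 : 0 \notin map fst s.
  by apply/mapP => -[p ps p0]; have := allP s0 _ ps; rewrite -p0 eqxx.
have [M M0 HM] := nondegeneracy_exponent sN0.
apply: (cvg_avg_residues M0); first by move=> n; case: (0 < f n); rewrite ?normr1 ?normr0.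
move=> b _; pose F n := (f (M * n + b)%N)%:C.
pose sb : seq (R[i] * {poly R[i]}) :=
  [seq (p.1 ^+ M, p.1 ^+ b *: (p.2 \Po (M%:R *: 'X + b%:R%:P))) | p <- s].
have sb0 : all (fun p => p.1 != 0) sb.
  by apply/allP => _ /mapP[p ps ->] /=; rewrite expf_neq0 // (allP s0 _ ps).
have Fsb n : F n = exp_poly sb n by rewrite /F Hs exp_poly_subsequence.
have [t [P [nf tsub]]] := exp_poly_normal_form sb0 Fsb.
(* The sequence may vanish identically along a residue class; its positive set there is empty. *)
have [tE|tN0] := eqVneq t [::].
  apply/cvg_ex; exists 0; apply: cvg_avg.
  have -> : (fun n => (0 < f (M * n + b)%N)%R%:R) = (fun=> 0 : R); last exact: cvg_cst.
  apply/funext => n; case: nf => _ _ _ /(_ n); rewrite tE big_nil => /complexI ->.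
  by rewrite ltxx.
have [rho [D [t1 [c [rho0 _ t1t [t1N0 t1_uniq t11 c0 lead]]]]]] := leading_part nf tN0.
pose r n := f (M * n + b)%N / (rho ^+ n * n%:R ^+ D).
(* Up to the factor [rho], a frequency is the [M]-th power of an original base, which is the form
   that [HM] handles. *)
have root_power z : z \in t1 -> exists2 y, y \in map fst s & z * rho%:C = y ^+ M.
  move=> /t1t/tsub/mapP[_ /mapP[p ps ->] ->]; exists p.1 => //; exact: map_f.
have rcvg : cvgn (avg (fun n => (0 < r n)%R%:R : R)).
  apply: (trig_sign_density t1N0 t1_uniq t11 _ c0).
    move=> z w zt1 wt1 j j0 zw.
    have [y ys yE] := root_power _ zt1; have [y' y's y'E] := root_power _ wt1.
    have rhoC0 : rho%:C != 0 by rewrite (inj_eq (@complexI R) _ 0) gt_eqF.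
    apply: (mulIf rhoC0); rewrite yE y'E; apply: HM j0 _ => //.
    by rewrite -yE -y'E !exprMn zw.
  apply: vanishes_ext lead => n; congr (_ - _).
  by rewrite /r /F rmorphM fmorphV rmorphM !rmorphXn rmorph_nat.
have /cvg_ex[l rl] := rcvg; apply/cvg_ex; exists l.
(* At [n = 0] the scale [n%:R ^+ D] is 0 if [D] is positive, so signs are compared only for positive
   [n]. *)
apply: avg_near_eq rl; near=> n.
have n0 : (0 < n)%N by near: n; exists 1%N.
by rewrite /r pmulr_lgt0 // invr_gt0 mulr_gt0 ?exprn_gt0 ?ltr0n.
Unshelve. all: by end_near. Qed.

End SignDensity.

(** * Mean squares and positivity *)

Section MeanSquare.
Variable R : realType.
Implicit Types (u : nat -> R[i]) (t : seq R[i]) (c : R[i] -> R[i]).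
Local Notation normc := ComplexField.Normc.normc.

Lemma mulc_conj (z : R[i]) : z * (z^*)%C = (normc z ^+ 2)%:C.
Proof. by rewrite -sqr_normc normcE rmorphXn. Qed.

Lemma vanishes_conj u : vanishes u -> vanishes (fun n => ((u n)^*)%C).
Proof.
apply: vanishes_le; near=> n.
by rewrite (_ : normc ((u n)^*)%C = normc (u n)) //; apply: complexI; rewrite -!normcE normcJ.
Unshelve. all: by end_near. Qed.

(** Parseval: the frequencies of the product are [z] times the conjugate of [w], which equals 1 only
    for [z = w], so only diagonal terms have nonzero mean. *)
Lemma trig_mean_square t c : uniq t -> {in t, forall z, normc z = 1} ->
  mean_to (fun n => (\sum_(z <- t) c z * z ^+ n) * ((\sum_(z <- t) c z * z ^+ n)^*)%C)
          (\sum_(z <- t) normc (c z) ^+ 2)%:C.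
Proof.
move=> t_uniq t1.
pose s := trig_terms t c.
pose s' : seq (R[i] * R[i]) := [seq (((c z)^*)%C, (z^*)%C) | z <- t].
have s1 : unimodular s by exact: unimodular_trig_terms.
have s'1 : unimodular s'.
  apply/allP => _ /mapP[z zt ->]; apply/eqP/complexI.
  by rewrite /= -normcE normcJ normcE t1.
have := trig_mean (unimodular_mul s1 s'1); rewrite /mean_to.
have -> : \sum_(p <- trig_mul s s') p.1 * (p.2 == 1)%:R = (\sum_(z <- t) normc (c z) ^+ 2)%:C.
  rewrite /trig_mul big_allpairs_dep /= big_map rmorph_sum /= big_seq [RHS]big_seq.
  apply: eq_bigr => z zt; rewrite big_map (bigD1_seq z) //= !mulc_conj (t1 z zt) expr1n eqxx mulr1.
  rewrite big_seq_cond big1 ?addr0 // => w /andP[wt wz].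
  case: eqP => [zw|_]; last by rewrite mulr0.
  have /eqP[] := wz.
  have ww : w * (w^*)%C = 1 by rewrite mulc_conj (t1 w wt) expr1n.
  by rewrite -[w]mul1r -zw mulrAC -mulrA ww mulr1.
apply: vanishes_ext => N; congr (_ / _ - _); apply: eq_bigr => n _.
rewrite trig_mulE trig_termsE; congr (_ * _).
by rewrite /trig big_map rmorph_sum; apply: eq_bigr => z _; rewrite rmorphM rmorphXn.
Qed.

Lemma mean_square_gt0 t c : t != [::] -> {in t, forall z, c z != 0} ->
  0 < \sum_(z <- t) normc (c z) ^+ 2 :> R.
Proof.
case: t => // z t _ c0; rewrite big_cons ltr_pwDl ?sumr_ge0 //.
  by rewrite exprn_gt0 // normc_gt0 c0 // mem_head.
by move=> w _; rewrite exprn_ge0 // normc_ge0.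
Qed.

(** Otherwise the mean square would be 0, against its positive value. *)
Lemma trig_not_vanishing t c : t != [::] -> uniq t -> {in t, forall z, normc z = 1} ->
  {in t, forall z, c z != 0} -> ~ vanishes (fun n => \sum_(z <- t) c z * z ^+ n).
Proof.
move=> tN0 t_uniq t1 c0 g0.
have b := vanishes_bounded (vanishes_conj g0).
have gg0 := vanishes_bounded_mul b g0.
have := mean_to_unique (trig_mean_square c t_uniq t1)
  (mean_to_vanishes (vanishes_ext (fun n => mulrC _ _) gg0)).
move=> /(@complexI R _ 0) V0; have := mean_square_gt0 tN0 c0.
by rewrite V0 ltxx.
Qed.

Lemma asymp_real_means (r : nat -> R) t c : uniq t -> {in t, forall z, normc z = 1} ->
  1 \notin t -> vanishes (fun n => (r n)%:C - \sum_(z <- t) c z * z ^+ n) ->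
  avg r @ \oo --> (0 : R) /\
  avg (fun n => r n ^+ 2) @ \oo --> \sum_(z <- t) normc (c z) ^+ 2.
Proof.
move=> t_uniq t1 Nt1 rg; pose g n := \sum_(z <- t) c z * z ^+ n; split.
  have := mean_toD (mean_to_vanishes rg) (trig_mean (unimodular_trig_terms c t1)).
  rewrite big_map big_seq big1 => [|z zt /=]; last first.
    by case: eqP => [z1|_]; rewrite ?mulr0 //; move: Nt1; rewrite -z1 zt.
  rewrite addr0 (_ : (fun _ => _) = (fun n => (r n)%:C)) => [/mean_to_avg//|].
  by apply/funext => n; rewrite trig_termsE subrK.
have gb : bounded_seq (fun n => ((g n)^*)%C).
  have := trig_bounded (unimodular_trig_terms c t1); case=> B HB; exists B => n.
  rewrite (_ : normc ((g n)^*)%C = normc (g n)); first by rewrite /g -trig_termsE.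
  by apply: complexI; rewrite -!normcE normcJ.
have rb : bounded_seq (fun n => (r n)%:C).
  apply: asymp_trig_bounded; exists (trig_terms t c); first exact: unimodular_trig_terms.
  by apply: vanishes_ext rg => n; rewrite trig_termsE.
(* With bars for conjugates, [r ^ 2 - g * gbar] is [r] times the conjugate of [r - g], plus
   [gbar * (r - g)]; both products are a bounded sequence times a null one. *)
have E := vanishesD (vanishes_bounded_mul rb (vanishes_conj rg)) (vanishes_bounded_mul gb rg).
have := mean_toD (mean_to_vanishes E) (trig_mean_square c t_uniq t1).
rewrite add0r (_ : (fun _ => _) = (fun n => (r n ^+ 2)%:C)) => [/mean_to_avg//|].
apply/funext => n; rewrite -/(g n) rmorphXn.
have -> : (((r n)%:C - g n)^*)%C = (r n)%:C - ((g n)^*)%C by rewrite rmorphB /= oppr0.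
by ring.
Qed.

Lemma positive_part_density (r : nat -> R) (B V d : R) : (forall n, `|r n| <= B) ->
  avg r @ \oo --> (0 : R) -> avg (fun n => r n ^+ 2) @ \oo --> V -> 0 < V ->
  avg (fun n => (0 < r n)%R%:R) @ \oo --> d -> 0 < d.
Proof.
move=> rB r0 rV V0 rd.
(* For positive [r n], both [r n ^+ 2] and [B * r n] are at most [B ^+ 2]; otherwise [- r n <= B] is
   multiplied by [- r n]. *)
have pointwise n : r n ^+ 2 <= 2 * B ^+ 2 * (0 < r n)%R%:R + - B * r n.
  have /andP[rB1 rB2] : - B <= r n <= B by rewrite -ler_norml.
  have [rn0|rn0] := ltP 0 (r n); rewrite ?mulr1n ?mulr0n; nra.
have lim : (fun N => 2 * B ^+ 2 * avg (fun n => (0 < r n)%R%:R) N + - B * avg r N)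
    @ \oo --> 2 * B ^+ 2 * d + - B * 0.
  by apply: cvgD; apply: cvgM => //; exact: cvg_cst.
have : V <= 2 * B ^+ 2 * d + - B * 0.
  apply: (ler_cvg_to rV lim); near=> N.
  by rewrite -!avgZ -avgD; exact: ler_avg.
rewrite mulr0 addr0 => VB; have := lt_le_trans V0 VB.
have B20 : 0 <= 2 * B ^+ 2 by rewrite mulr_ge0 // sqr_ge0.
by have [//|d0] := ltP 0 d; rewrite ltNge mulr_ge0_le0.
Unshelve. all: by end_near. Qed.

End MeanSquare.

(** * Characteristic roots and the dominating modulus *)

Section CharacteristicRoots.
Variables (R : realType) (f : nat -> R).
Local Notation normc := ComplexField.Normc.normc.

Lemma normal_form_characteristic_root t P (z : R[i]) :
  normal_form (fun n => (f n)%:C) t P -> z \in t -> characteristic_root f z.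
Proof.
move=> [t_uniq t0 P0 HF] zt.
exists (size t), (fun k => nth 0 t k), (fun k => P (nth 0 t k)); split.
  split.
  - by move=> i j /eqP; rewrite nth_uniq // => /eqP/val_inj.
  - by move=> k; apply: contraNneq t0 => <-; exact: mem_nth.
  - by move=> k; apply: P0; exact: mem_nth.
  by move=> n; rewrite HF (big_nth 0) big_mkord.
have zi : (index z t < size t)%N by rewrite index_mem.
by exists (Ordinal zi); rewrite /= nth_index.
Qed.

Lemma characteristic_root_normal_form (z : R[i]) : characteristic_root f z ->
  exists t P, normal_form (fun n => (f n)%:C) t P /\ z \in t.
Proof.
case=> m [gamma [P [[gammaI gamma0 P0 HF] [k ->]]]].
(* This turns the family indexed by ordinals into a function of the base; by injectivity of [gamma],
   the sum at [gamma j] has the single term [P j]. *)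
pose Q w := \sum_(j | gamma j == w) P j.
have QE j : Q (gamma j) = P j.
  by rewrite /Q (big_pred1 j) // => i; rewrite /= (inj_eq gammaI).
exists [seq gamma j | j <- enum 'I_m], Q; split; last first.
  by rewrite map_f // mem_enum.
split.
- by rewrite map_inj_uniq // enum_uniq.
- by apply/mapP => -[j _ /eqP]; rewrite eq_sym (negbTE (gamma0 j)).
- by move=> _ /mapP[j _ ->]; rewrite QE.
by move=> n; rewrite HF big_map big_enum /=; apply: eq_bigr => j _; rewrite QE.
Qed.

(** [w] may come from any representation of [f]. If the radius [rho'] of that one exceeded [rho],
    then [f] divided by its scale would tend to 0, so the trigonometric polynomial leading there
    would vanish in the limit. *)
Lemma leading_part_radius_max (rho : R) (D : nat) t1 (c : R[i] -> R[i]) (w : R[i]) :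
  0 < rho ->
  {in t1, forall z, normc z = 1} ->
  vanishes (fun n => (f n)%:C / (rho%:C ^+ n * n%:R ^+ D) - \sum_(z <- t1) c z * z ^+ n) ->
  characteristic_root f w -> normc w <= rho.
Proof.
move=> rho0 t11 lead /characteristic_root_normal_form[t' [P' [nf' wt']]].
have t'N0 : t' != [::] by case: (t') wt'.
have [rho' [D' [t1' [c' [rho'0 t'rho' _ [t1'N0 t1'_uniq t1'1 c'0 lead']]]]]] :=
  leading_part nf' t'N0.
apply: le_trans (t'rho' _ wt') _; rewrite leNgt; apply/negP => lt_rho.
apply: (trig_not_vanishing t1'N0 t1'_uniq t1'1 c'0).
have bounded : bounded_seq (fun n => (f n)%:C / (rho%:C ^+ n * n%:R ^+ D)).
  apply: asymp_trig_bounded; exists (trig_terms t1 c); first exact: unimodular_trig_terms.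
  by apply: vanishes_ext lead => n; rewrite trig_termsE.
have q1 : normc (rho%:C / rho'%:C) < 1.
  by rewrite normcM normcV !normc_real !gtr0_norm // ltr_pdivrMr // mul1r.
(* The quotient is a bounded sequence times [n ^ D * (rho / rho') ^ n] over [n ^ D'], and the
   geometric factor wins. *)
have f0 : vanishes (fun n => (f n)%:C / (rho'%:C ^+ n * n%:R ^+ D')).
  have := vanishes_bounded_mul bounded (vanishes_bounded_mul (bounded_inv_power R D')
    (poly_geometric_vanishes 'X^D q1)).
  apply: vanishes_le; near=> n.
  have n0 : (n%:R : R[i]) != 0 by rewrite pnatr_eq0 -lt0n; near: n; exists 1%N.
  rewrite le_eqVlt; apply/orP; left; apply/eqP; congr normc.
  have rhoC0 : rho%:C != 0 by rewrite (inj_eq (@complexI R) _ 0) gt_eqF.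
  have rho'C0 : rho'%:C != 0 by rewrite (inj_eq (@complexI R) _ 0) gt_eqF.
  rewrite hornerXn expr_div_n; move: (expf_neq0 n rhoC0) (expf_neq0 n rho'C0).
  move: (expf_neq0 D n0) (expf_neq0 D' n0).
  move: (n%:R ^+ D) (n%:R ^+ D') (rho%:C ^+ n) (rho'%:C ^+ n) => x x' y y' x0 x'0 y0 y'0.
  by field; rewrite x0 x'0 y0 y'0.
by apply: vanishes_ext (vanishesD f0 (vanishesN lead')) => n; ring.
Unshelve. all: by end_near. Qed.

End CharacteristicRoots.

(** * Natural densities and the conclusion *)

Lemma natural_density_of_avg (R : realType) (A : pred nat) (d : R) :
  avg (fun n => (A n)%:R) @ \oo --> d -> has_natural_density [set n : nat | A n] d.
Proof.
move=> Ad; rewrite /has_natural_density.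
(* The density divides a count over the [x + 1] numbers up to [x] by [x]; the factor [1 + 1 / x]
   corrects the average over [x + 1] terms. *)
have Sd : (fun x => avg (fun n => (A n)%:R : R) x.+1 * (1 + 1 / x%:R)) @ \oo --> d.
  rewrite -[d]mulr1 -[X in d * X]addr0; apply: cvgM.
    by have := Ad; rewrite -cvg_shiftS.
  by apply: cvgD; [exact: cvg_cst | exact: cvg_div_nat].
apply: cvg_trans Sd; apply: near_eq_cvg; near=> x.
have x0 : (x%:R : R) != 0 by rewrite pnatr_eq0 -lt0n; near: x; exists 1%N.
have x10 : (x.+1%:R : R) != 0 by rewrite pnatr_eq0.
rewrite -sum1_card natr_sum big_mkcond /avg.
rewrite [in RHS](eq_bigr (fun n : 'I_x.+1 => (A n)%:R : R)) => [|n _]; last first.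
  by rewrite inE; case: (boolP (A n)) => An; [rewrite mem_set | rewrite memNset //; exact/negP].
have -> : 1 + 1 / x%:R = x.+1%:R / x%:R :> R by rewrite -natr1; field.
by rewrite mulrA divfK.
Unshelve. all: by end_near. Qed.

Theorem theorem2 (R : realType) (f : nat -> R)
    (f_rec : recurrence_sequence f)
    (f_neq0 : exists n : nat, f n <> 0)
    (no_pos_dom : ~ exists r : R, 0 < r /\ dominating_root f r%:C) :
  (exists d : R, 0 < d /\ has_natural_density [set n : nat | 0 < f n] d) /\
  (exists d : R, 0 < d /\ has_natural_density [set n : nat | f n < 0] d).
Proof.
have [s s0 Hs] := recurrence_exp_poly f_rec.
have [t [P [nf _]]] := exp_poly_normal_form s0 Hs.
have tN0 : t != [::].
  case: f_neq0 => n fn0; apply/eqP => tE; apply: fn0; apply: complexI.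
  by case: nf => _ _ _ ->; rewrite tE big_nil.
have [rho [D [t1 [c [rho0 trho t1t [t1N0 t1_uniq t11 c0 lead]]]]]] := leading_part nf tN0.
(* A frequency 1 would make [rho] a characteristic root; its modulus is maximal over all
   representations, so it would be a positive dominating root. *)
have Nt1 : 1 \notin t1.
  apply/negP => /t1t; rewrite mul1r => rhot; apply: no_pos_dom; exists rho; split => //.
  split; first exact: normal_form_characteristic_root nf rhot.
  move=> w /(leading_part_radius_max rho0 t11 lead) wrho.
  by rewrite !normcE lecR normc_real gtr0_norm.
pose r n := f n / (rho ^+ n * n%:R ^+ D).
have rlead : vanishes (fun n => (r n)%:C - \sum_(z <- t1) c z * z ^+ n).
  apply: vanishes_ext lead => n; congr (_ - _).
  by rewrite /r rmorphM fmorphV rmorphM !rmorphXn rmorph_nat.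
have [rm rm2] := asymp_real_means t1_uniq t11 Nt1 rlead.
have V0 := mean_square_gt0 t1N0 c0.
have [B _ rB] : exists2 B, 0 < B & forall n, `|r n| <= B.
  apply: asymp_trig_real_bound; exists (trig_terms t1 c); first exact: unimodular_trig_terms.
  by apply: vanishes_ext rlead => n; rewrite trig_termsE.
have scale0 n : (0 < n)%N -> 0 < (rho ^+ n * n%:R ^+ D)^-1.
  by move=> n0; rewrite invr_gt0 mulr_gt0 ?exprn_gt0 ?ltr0n.
split.
  have /cvg_ex[d fd] := exp_poly_sign_density (ex_intro2 _ _ s s0 Hs).
  exists d; split; last exact: natural_density_of_avg.
  apply: (positive_part_density rB rm rm2 V0); apply: avg_near_eq fd.
  by exists 1%N => // n /= n0; rewrite /r pmulr_lgt0 // scale0.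
(* The negative set is the positive set of [- f]: the rescaled sequence becomes [- r], again of mean
   0, with the same bound and mean square. *)
have Nexp : is_exp_poly (fun n => (- f n)%:C).
  exists [seq (p.1, - p.2) | p <- s]; first by rewrite all_map.
  move=> n; rewrite rmorphN [X in - X]Hs /exp_poly big_map -sumrN; apply: eq_bigr => p _ /=.
  by rewrite hornerN mulNr.
have /cvg_ex[d fd] := exp_poly_sign_density Nexp.
exists d; split; last first.
  apply: natural_density_of_avg; apply: avg_near_eq fd.
  by exists 0%N => // n _; rewrite oppr_gt0.
apply: (@positive_part_density _ (fun n => - r n) B _ _ _ _ _ V0).
- by move=> n; rewrite normrN.
- have -> : avg (fun n => - r n) = (fun N => - avg r N).
    by apply/funext => N; rewrite /avg sumrN mulNr.
  by rewrite -oppr0; exact: cvgN.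
- by under eq_fun do rewrite sqrrN.
apply: avg_near_eq fd.
by exists 1%N => // n /= n0; rewrite /r -mulNr pmulr_lgt0 // scale0.
Qed.
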